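(* Let $(X,d)$ be a metric space and let $\mathcal{R}\subset C(\mathbb{R}^+,X)$ satisfy (K1)-(K4), with associated multivalued semiflow $G$. Let $K\neq\emptyset$ be a closed isolated weakly invariant set, and suppose that $\mathcal{R}$ satisfies (K5) for $K$. Suppose that there is a closed isolating neighborhood $N$ of $K$ which is $G$-admissible. Then there exists an isolating block $B$ of $K$ with $K\subset B\subset N$.
   Context: $\mathbb{R}^+=[0,\infty)$. Conditions on $\mathcal{R}\subset C(\mathbb{R}^+,X)$: (K1) For any $x\in X$ there is $\phi\in\mathcal{R}$ with $\phi(0)=x$. (K2) If $\phi\in\mathcal{R}$, then $\phi(\tau+\cdot)\in\mathcal{R}$ for all $\tau\ge 0$. (K3) If $\phi_1,\phi_2\in\mathcal{R}$ and $\phi_1(s)=\phi_2(0)$ for some $s\ge0$, then the function equal to $\phi_1(t)$ on $[0,s]$ and to $\phi_2(t-s)$ on $(s,\infty)$ belongs to $\mathcal{R}$. (K4) If $\{\phi_n\}\subset\mathcal{R}$ and $\phi_n(0)\to x\in X$, then there is $\phi\in\mathcal{R}$ with $\phi(0)=x$ such that, up to a subsequence, $\phi_n\to\phi$ uniformly on compact subsets of $\mathbb{R}^+$. (K5) (for a closed isolated weakly invariant set $K$) There is an open neighborhood $\mathcal{O}(K)$ of $K$ such that for any $x\in\mathcal{O}(K)$, any $\phi\in\mathcal{R}$ with $\phi(0)=x$ and any sequence $x_n\to x$ there are a subsequence $x_{n_k}$ and $\phi_{n_k}\in\mathcal{R}$ with $\phi_{n_k}(0)=x_{n_k}$ such that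 $\phi_{n_k}\to\phi$ uniformly on compact subsets of $[0,t_\phi)$, where $t_\phi=\sup\{t:\phi([0,t])\subset\mathcal{O}(K)\}$. The multivalued semiflow associated with $\mathcal{R}$ is $G(t,x)=\{\phi(t):\phi\in\mathcal{R},\ \phi(0)=x\}$. A complete trajectory of $\mathcal{R}$ is a function $\phi:\mathbb{R}\to X$ with $\phi(\tau+\cdot)|_{[0,\infty)}\in\mathcal{R}$ for all $\tau\in\mathbb{R}$. A set $A\subset X$ is weakly invariant if for each $x\in A$ there is a complete trajectory $\phi$ of $\mathcal{R}$ with $\phi(0)=x$ and $\phi(\mathbb{R})\subset A$. A closed set $A$ is an isolated weakly invariant set if it is weakly invariant and there is an open neighborhood $U$ of $A$ such that $A$ is the maximal weakly invariant set in $U$. A closed set $N$ is an isolating neighborhood of $A$ if $A\subset \operatorname{int}N$ and $A$ is the maximal weakly invariant set in $N$. A closed set $N$ is $G$-admissible if for all sequences $t_n\to+\infty$ and $\phi_n\in\mathcal{R}$ with $\phi_n([0,t_n])\subset N$ for all $n$, the sequence $\{\phi_n(t_n)\}$ has a convergent subsequence. Let $B\subset X$ be closed and $x\in\partial B$. Consider all functions $\sigma:[-\delta_1,+\infty)\to X$, $\delta_1\ge 0$, with $\sigma(-\delta_1+\cdot)\in\mathcal{R}$ and $\sigma(0)=x$. The point $x$ is - an egress point if for every such $\sigma$: there is $\varepsilon_2>0$ with $\sigma(t)\notin B$ for $t\in(0,\varepsilon_2]$; and, if $\delta_1>0$, there is $\varepsilon_1\in(0,\delta_1)$ with $\sigma(t)\in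 B$ for $t\in[-\varepsilon_1,0)$; - an ingress point if for every such $\sigma$: there is $\varepsilon_2>0$ with $\sigma(t)\in\operatorname{int}B$ for $t\in(0,\varepsilon_2]$; and, if $\delta_1>0$, there is $\varepsilon_1\in(0,\delta_1)$ with $\sigma(t)\notin B$ for $t\in[-\varepsilon_1,0)$; - a bounce-off point if for every such $\sigma$: there is $\varepsilon_2>0$ with $\sigma(t)\notin B$ for $t\in(0,\varepsilon_2]$; and, if $\delta_1>0$, there is $\varepsilon_1\in(0,\delta_1)$ with $\sigma(t)\notin B$ for $t\in[-\varepsilon_1,0)$. The sets of egress, ingress and bounce-off points are $B^e,B^i,B^b$, and $B^-=B^e\cup B^b$. An isolating block of $K$ is a closed set $B\subset X$ which is an isolating neighborhood of $K$, with $\partial B=B^-\cup B^i$ and $B^-$ closed. *)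

(* Defs.v *)
From HB Require Import structures.
From mathcomp Require Import all_boot all_order all_algebra.
From mathcomp Require Import all_classical all_reals all_analysis.

Set Implicit Arguments.
Unset Strict Implicit.
Unset Printing Implicit Defensive.

Import Order.TTheory GRing.Theory Num.Theory.
Import numFieldTopology.Exports.

Local Open Scope classical_set_scope.
Local Open Scope ring_scope.

(* The half-line [0, +oo) as a type, with the topology induced by R, so that
   a subset of C([0, +oo), X) is a genuine set of functions and carries no
   spurious values at negative times. *)
Definition halfline (R : realType) : set R := [set t | 0 <= t].
Arguments halfline R : clear implicits.
Notation Rplus R := (set_type (halfline R)).

Lemma max0_halfline (R : realType) (t : R) : Num.max 0 t \in halfline R.
Proof. by rewrite inE /halfline /= le_max lexx. Qed.

(* The point t of the half-line when 0 <= t. Below it is only applied to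
   nonnegative numbers; the value 0 at t < 0 is never used. *)
Definition toRplus (R : realType) (t : R) : Rplus R :=
  exist _ (Num.max 0 t) (max0_halfline t).

Section multivalued_semiflows.
Context {R : realType} {X : metricType R}.

Implicit Types (phi : Rplus R -> X) (calR : set (Rplus R -> X)).
Implicit Types (A B K N U : set X).

Definition shift (tau : R) phi : Rplus R -> X :=
  fun t => phi (toRplus (tau + val t)).

Definition concat (s : R) phi1 phi2 : Rplus R -> X :=
  fun t => if val t <= s then phi1 t else phi2 (toRplus (val t - s)).

Definition condK1 calR : Prop :=
  forall x : X, exists2 phi, calR phi & phi (toRplus 0) = x.

Definition condK2 calR : Prop :=
  forall phi, calR phi -> forall tau : R, 0 <= tau -> calR (shift tau phi).

Definition condK3 calR : Prop :=
  forall phi1 phi2 (s : R), calR phi1 -> calR phi2 -> 0 <= s ->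
    phi1 (toRplus s) = phi2 (toRplus 0) -> calR (concat s phi1 phi2).

Definition condK4 calR : Prop :=
  forall (phi_ : nat -> Rplus R -> X) (x : X),
    (forall n, calR (phi_ n)) ->
    phi_ n (toRplus 0) @[n --> \oo] --> x ->
    exists2 phi, calR phi /\ phi (toRplus 0) = x &
      exists2 k : nat -> nat, increasing_seq k &
        {family compact, phi_ (k n) @[n --> \oo] --> phi}.

(* sup {t >= 0 | phi([0, t]) is contained in U}, possibly +oo. *)
Definition exit_time U phi : \bar R :=
  ereal_sup [set (val t)%:E | t in
    [set t : Rplus R | forall s : Rplus R, val s <= val t -> U (phi s)]].

Definition condK5 calR K : Prop :=
  exists O : set X, [/\ open O, K `<=` O &
    forall (x : X) phi (x_ : nat -> X),
      O x -> calR phi -> phi (toRplus 0) = x -> x_ n @[n --> \oo] --> x ->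
      exists (k : nat -> nat) (phi_ : nat -> Rplus R -> X),
        [/\ increasing_seq k,
            forall n, calR (phi_ n) /\ phi_ n (toRplus 0) = x_ (k n) &
            {family [set C : set (Rplus R) | compact C /\
                       forall t, C t -> ((val t)%:E < exit_time O phi)%E],
              phi_ n @[n --> \oo] --> phi}]].

Definition complete_trajectory calR (phi : R -> X) : Prop :=
  forall tau : R, calR (fun t : Rplus R => phi (tau + val t)).

Definition weakly_invariant calR A : Prop :=
  forall x, A x -> exists phi : R -> X,
    [/\ complete_trajectory calR phi, phi 0 = x & range phi `<=` A].

Definition maximal_weakly_invariant_in calR U A : Prop :=
  [/\ weakly_invariant calR A, A `<=` U &
      forall A', weakly_invariant calR A' -> A' `<=` U -> A' `<=` A].

Definition isolated_weakly_invariant calR A : Prop :=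
  [/\ closed A, weakly_invariant calR A &
      exists U : set X,
        [/\ open U, A `<=` U & maximal_weakly_invariant_in calR U A]].

Definition isolating_neighborhood calR A N : Prop :=
  [/\ closed N, A `<=` N° & maximal_weakly_invariant_in calR N A].

(* Admissibility with respect to G(t, x) = {phi(t) | phi in calR, phi(0) = x}:
   it refers to G only through calR. *)
Definition admissible calR N : Prop :=
  closed N /\
  forall (t_ : nat -> Rplus R) (phi_ : nat -> Rplus R -> X),
    val (t_ n) @[n --> \oo] --> +oo ->
    (forall n, calR (phi_ n)) ->
    (forall n (s : Rplus R), val s <= val (t_ n) -> N (phi_ n s)) ->
    exists2 k : nat -> nat, increasing_seq k &
      exists x : X, phi_ (k n) (t_ (k n)) @[n --> \oo] --> x.

Definition boundary B : set X := closure B `\` B°.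

(* sigma : [-delta1, +oo) -> X with sigma(-delta1 + .) in calR, sigma(0) = x.
   sigma is totalised to R; its values below -delta1 are arbitrary and are
   inspected by none of the definitions below. *)
Definition trajectory_through calR (x : X) (delta1 : R) (sigma : R -> X) :=
  [/\ 0 <= delta1, calR (fun t : Rplus R => sigma (- delta1 + val t)) &
      sigma 0 = x].

Definition egress calR B : set X := [set x | boundary B x /\
  forall delta1 sigma, trajectory_through calR x delta1 sigma ->
    (exists2 e2 : R, 0 < e2 & forall t, 0 < t <= e2 -> ~ B (sigma t)) /\
    (0 < delta1 -> exists2 e1 : R, 0 < e1 < delta1 &
       forall t, - e1 <= t < 0 -> B (sigma t))].

Definition ingress calR B : set X := [set x | boundary B x /\
  forall delta1 sigma, trajectory_through calR x delta1 sigma ->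
    (exists2 e2 : R, 0 < e2 & forall t, 0 < t <= e2 -> B° (sigma t)) /\
    (0 < delta1 -> exists2 e1 : R, 0 < e1 < delta1 &
       forall t, - e1 <= t < 0 -> ~ B (sigma t))].

Definition bounce_off calR B : set X := [set x | boundary B x /\
  forall delta1 sigma, trajectory_through calR x delta1 sigma ->
    (exists2 e2 : R, 0 < e2 & forall t, 0 < t <= e2 -> ~ B (sigma t)) /\
    (0 < delta1 -> exists2 e1 : R, 0 < e1 < delta1 &
       forall t, - e1 <= t < 0 -> ~ B (sigma t))].

Definition exit_set calR B : set X := egress calR B `|` bounce_off calR B.

Definition isolating_block calR K B : Prop :=
  [/\ closed B, isolating_neighborhood calR K B,
      boundary B = exit_set calR B `|` ingress calR B &
      closed (exit_set calR B)].

End multivalued_semiflows.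

(* Main.v *)
Require Import Defs.
From mathcomp Require Import all_boot all_order all_algebra.
From mathcomp Require Import all_classical all_reals all_analysis.
From mathcomp Require Import lra.

(* Idea. Let D be the distance to K, let L be the set of limits of phi_n(t_n)
   with t_n --> +oo and phi_n([0, t_n]) in N, let {D <= 2 rho} lie in N and in
   the open set of (K5), and put alpha(t) = 2 - 1 / (1 + t).  For continuous
   F >= 0 consider
     Z_F(x) = sup { c alpha(t) F(phi(t)) | phi from x, 0 <= c <= 1,
                    D(phi(s)) <= (2 - c) rho for all s in [0, t] }.
   By (K3) and since alpha increases, Z_F strictly decreases along every
   trajectory in {D <= rho} as long as the supremum is attained.  The factor c
   penalises paths that approach the edge of the tube, so that no exit time is
   needed: lower semicontinuity of Z_F is (K5), upper semicontinuity and
   attainment are (K4) and admissibility.  For F = d(., L) near K this needs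
   nothing else; for F = 1 it also needs that no trajectory starting close to K
   leaves {D <= rho} and stays in N forever, which follows from the maximality
   of K.  The block is B = {Z_1 >= 2 - e, Z_{d(., L)} <= e} with e small: it is
   close to K because Z_1 = 2 means staying in N forever and Z_{d(., L)} = 0
   means lying in L.  Its exit set is the part of the boundary where
   Z_1 = 2 - e. *)

Set Implicit Arguments.
Unset Strict Implicit.
Unset Printing Implicit Defensive.

Import Order.TTheory GRing.Theory Num.Theory.
Import numFieldTopology.Exports.

Local Open Scope classical_set_scope.
Local Open Scope ring_scope.

Notation ev phi t := (phi (toRplus t)).

(** * The half-line and its compact initial segments *)

Section halfline.
Context {R : realType}.

Lemma toRplusK (t : R) : 0 <= t -> val (toRplus t) = t.
Proof. by move=> t0 /=; apply/max_idPr. Qed.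

Lemma toRplus_val (t : Rplus R) : toRplus (val t) = t.
Proof.
by apply: val_inj; rewrite toRplusK//; have := valP t; rewrite inE.
Qed.

Lemma Rplus_ge0 (t : Rplus R) : 0 <= val t.
Proof. by have := valP t; rewrite inE. Qed.

Lemma toRplus_continuous : continuous (@toRplus R).
Proof.
apply: continuous_comp_initial => t.
have cmax : continuous (fun t : R => Num.max 0 t).
  by move=> u; apply: (@continuous_max _ _ (fun=> 0) id); [exact: cvg_cst|exact: cvg_id].
exact: cmax.
Qed.

(** Turns the convergence on compact sets in (K4) and (K5) into uniform convergence on initial
    segments. *)
Lemma compact_initial_segment (T : R) : compact [set t : Rplus R | val t <= T].
Proof.
have [T0|T0] := leP 0 T; last first.
  suff -> : [set t : Rplus R | val t <= T] = set0 by exact: compact0.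
  apply/seteqP; split=> // t /= tT.
  by have := Rplus_ge0 t; rewrite leNgt (le_lt_trans tT).
have -> : [set t : Rplus R | val t <= T] = @toRplus R @` `[0, T]%classic.
  apply/seteqP; split=> [t /= tT|_ [s /= + <-]].
    by exists (val t); [rewrite /= in_itv/= Rplus_ge0|exact: toRplus_val].
  by rewrite in_itv/= => /andP[s0 sT]; rewrite (max_idPr s0).
apply: continuous_compact; last exact: segment_compact.
by apply: continuous_subspaceT; exact: toRplus_continuous.
Qed.

End halfline.

(* [mdist] with values in R itself: its own codomain is the carrier of R as a
   numDomainType, and lra does not see through that coercion path. *)
Section metric.
Context {R : realType} {X : metricType R}.

Definition dist (x y : X) : R := mdist x y.

Lemma dist_ge0 x y : 0 <= dist x y.
Proof. exact: mdist_ge0. Qed.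

Lemma distxx x : dist x x = 0.
Proof. exact: mdistxx. Qed.

Lemma distC x y : dist x y = dist y x.
Proof. exact: metric_sym. Qed.

Lemma dist_trans y x z : dist x z <= dist x y + dist y z.
Proof. exact: metric_triangle. Qed.

Lemma ball_dist x (e : R) : ball x e = [set y | dist x y < e].
Proof. exact: ballEmdist. Qed.

Lemma nbhs_distP x (P : set X) :
  nbhs x P <-> exists2 e : R, 0 < e & forall y, dist x y < e -> P y.
Proof.
split=> [/nbhs_ballP[e e0 eP]|[e e0 eP]].
  by exists e => // y xy; apply: eP; rewrite ball_dist.
by apply/nbhs_ballP; exists e => // y; rewrite ball_dist; exact: eP.
Qed.

Lemma cvg_distP (u : nat -> X) (l : X) : u n @[n --> \oo] --> l <->
  forall e : R, 0 < e -> \forall n \near \oo, dist l (u n) < e.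
Proof. exact: metricType_numDomainType.cvgrPdist_lt. Qed.

Lemma closed_lim (A : set X) (u : nat -> X) (l : X) : closed A ->
  (\forall n \near \oo, A (u n)) -> u n @[n --> \oo] --> l -> A l.
Proof. by move=> cA Au; exact: (@closed_cvg _ _ _ _ u). Qed.

End metric.

(** * Concatenation, convergence along moving times, subsequences *)

Section trajectories.
Context {R : realType} {X : metricType R}.
Implicit Types (phi : Rplus R -> X).

Lemma ev_shift (tau t : R) phi : 0 <= t ->
  ev (Defs.shift tau phi) t = ev phi (tau + t).
Proof. by move=> t0; rewrite /Defs.shift toRplusK. Qed.

Lemma ev_concat_le (s t : R) phi psi : 0 <= t <= s ->
  ev (concat s phi psi) t = ev phi t.
Proof. by move=> /andP[t0 ts]; rewrite /concat toRplusK// ts. Qed.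

Lemma ev_concat_ge (s t : R) phi psi : 0 <= s -> 0 <= t ->
  ev phi s = ev psi 0 -> ev (concat s phi psi) (s + t) = ev psi t.
Proof.
move=> s0 t0 e; rewrite /concat toRplusK ?addr_ge0//.
(* The first branch of [concat] applies only at the junction [t = 0], which is where the matching
   hypothesis enters. *)
case: ifPn => [st|_]; last by rewrite addrAC subrr add0r.
have -> : t = 0 by apply/eqP; rewrite eq_le t0 andbT; move: st; rewrite gerDl.
by rewrite addr0.
Qed.

Lemma ev_continuous phi : continuous phi -> continuous (fun t => ev phi t).
Proof.
move=> cphi t; apply: continuous_comp; [exact: toRplus_continuous|exact: cphi].
Qed.

Lemma cvg_uniform_dist (T : choiceType) (A : set T) (f_ : nat -> T -> X) f :
  {uniform A, f_ n @[n --> \oo] --> f} -> forall e : R, 0 < e ->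
  \forall n \near \oo, forall y, A y -> dist (f y) (f_ n y) < e.
Proof.
move=> uf e e0.
suff /uf : nbhs (f : {uniform` A -> X})
  [set h | forall y, A y -> dist (f y) (h y) < e] by [].
apply/uniform_nbhs; exists [set xy | ball xy.1 e xy.2].
split; first exact: (entourage_ball _ (PosNum e0)).
by move=> h /= fh y /fh; rewrite ball_dist.
Qed.

Lemma increasing_seq_comp (k k' : nat -> nat) :
  increasing_seq k -> increasing_seq k' -> increasing_seq (k \o k').
Proof. by move=> ik ik' m n /=; rewrite ik. Qed.

Lemma increasing_seq_cvg (k : nat -> nat) : increasing_seq k ->
  k n @[n --> \oo] --> \oo.
Proof.
move=> ik P [m _ mP]; exists m => // n /= mn; apply: mP => /=.
apply: leq_trans mn _; elim: n => // n; rewrite -ltnS => /leq_trans; apply.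
by move/increasing_seqP : ik; exact.
Qed.

Lemma cvg_subseq (T : Type) (u : nat -> T) (F : set_system T) k :
  increasing_seq k -> u n @[n --> \oo] --> F -> u (k n) @[n --> \oo] --> F.
Proof. by move=> /increasing_seq_cvg ik; apply: cvg_comp. Qed.

(** The error splits into the uniform distance at time [s_ n] and the continuity of the limit [phi]
    at [s]. *)
Lemma cvg_ev_uniform (T : R) (phi_ : nat -> Rplus R -> X) phi (s_ : nat -> R) (s : R) :
  continuous phi ->
  {uniform [set t | val t <= T], phi_ n @[n --> \oo] --> phi} ->
  (\forall n \near \oo, 0 <= s_ n <= T) -> s_ n @[n --> \oo] --> s ->
  ev (phi_ n) (s_ n) @[n --> \oo] --> ev phi s.
Proof.
move=> cphi /cvg_uniform_dist uphi s_T s_s; apply/cvg_distP => e e0.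
have e20 : 0 < e / 2 by rewrite divr_gt0.
have : ev phi (s_ n) @[n --> \oo] --> ev phi s.
  exact: (cvg_comp _ (fun t => ev phi t) s_s (@ev_continuous phi cphi s)).
move=> /cvg_distP/(_ _ e20) h1; have h2 := uphi _ e20.
near=> n; rewrite (le_lt_trans (dist_trans (ev phi (s_ n)) _ _))//.
rewrite [ltRHS]splitr ltrD//; first by near: n.
have /andP[s0 sT] : 0 <= s_ n <= T by near: n.
have h2n : forall y : Rplus R, val y <= T -> dist (phi y) (phi_ n y) < e / 2.
  by near: n; exact: h2.
by apply: h2n; rewrite toRplusK.
Unshelve. all: by end_near. Qed.

Lemma cvg_to_or_infty (s_ : nat -> R) : (forall n, 0 <= s_ n) ->
  (exists2 k, increasing_seq k & s_ (k n) @[n --> \oo] --> +oo) \/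
  (exists2 k, increasing_seq k & exists2 s : R, 0 <= s & s_ (k n) @[n --> \oo] --> s).
Proof.
move=> s0; have [[M sM]|nb] := pselect (exists M, forall n, s_ n <= M).
  right; have [|k ik ck] := @bolzano_weierstrass _ s_.
    exists M; split; first exact: num_real.
    by move=> M' MM' n _ /=; rewrite ger0_norm// (le_trans (sM n))// ltW.
  exists k => //; exists (lim (s_ (k n) @[n --> \oo])) => //.
  by apply: limr_ge => //; apply: nearW => n /=.
left; have unb M m : exists2 n, (m < n)%N & M < s_ n.
  apply: contrapT => h; apply: nb.
  (* The terms are nonnegative, so each one with index at most [m] is bounded by their sum; the
     later ones are bounded by [M]. *)
  exists (Num.max M (\sum_(i < m.+1) s_ i)) => n; rewrite le_max.
  have [nm|mn] := leqP n m.
    rewrite (bigD1 (Ordinal (nm : (n < m.+1)%N)))//= lerDl orbC.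
    by rewrite sumr_ge0.
  by have [//|Ms] := leP (s_ n) M; exfalso; apply: h; exists n.
have /choice[g gP] : forall p : nat * nat, exists n : nat, (p.2 < n)%N /\ p.1%:R < s_ n.
  by move=> [i m]; have [n mn sn] := unb i%:R m; exists n.
(* Each index is chosen beyond the previous one, with a value of [s_] above [n]. *)
pose k := fix k n := if n is n'.+1 then g (n'.+1, k n') else g (0, 0)%N.
exists k; first by apply/increasing_seqP => n; exact: (gP (n.+1, k n)).1.
have sk n : n%:R <= s_ (k n).
  by case: n => [|n] /=; apply: ltW; [exact: (gP (0, 0)%N).2|exact: (gP (n.+1, k n)).2].
apply/cvgryPge => M; near=> n; apply: le_trans (sk n).
by near: n; exact: nbhs_infty_ger.
Unshelve. all: by end_near. Qed.

End trajectories.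

(** * Distance to a set *)

Section distance.
Context {R : realType} {X : metricType R}.
Implicit Types (A : set X) (x y : X).

(** For empty [A] this is the default value 0 of [inf], hence the nonemptiness hypotheses below. *)
Definition dist_to A x : R := inf [set dist x a | a in A].

Let has_lb A x : has_lbound [set dist x a | a in A].
Proof. by exists 0 => _ [a _ <-]; exact: dist_ge0. Qed.

Lemma dist_to_ge0 A x : 0 <= dist_to A x.
Proof.
have [->|/set0P[a Aa]] := eqVneq A set0; first by rewrite /dist_to image_set0 inf0.
apply: lb_le_inf; first by exists (dist x a), a.
by move=> _ [b _ <-]; exact: dist_ge0.
Qed.

Lemma dist_to_le A x a : A a -> dist_to A x <= dist x a.
Proof. by move=> Aa; apply: ge_inf; [exact: has_lb|exists a]. Qed.

Lemma dist_to0 A a : A a -> dist_to A a = 0.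
Proof.
by move=> Aa; apply/eqP; rewrite eq_le dist_to_ge0 andbT -(distxx a) dist_to_le.
Qed.

Lemma dist_to_lt A x (e : R) : A !=set0 -> dist_to A x < e ->
  exists2 a, A a & dist x a < e.
Proof.
move=> [a0 Aa0] /inf_lt[|_ [a Aa <-] ae]; last by exists a.
by exists (dist x a0), a0.
Qed.

Lemma dist_to_triangle A x y : A !=set0 -> dist_to A x <= (dist x y) + dist_to A y.
Proof.
move=> A0; rewrite -lerBlDl; apply: lb_le_inf.
  by case: A0 => a Aa; exists (dist y a), a.
move=> _ [a Aa <-]; rewrite lerBlDl (le_trans (dist_to_le x Aa))//.
exact: dist_trans.
Qed.

Lemma dist_to_continuous A : A !=set0 -> continuous (dist_to A).
Proof.
move=> A0 x; apply/cvgrPdist_lt => e e0.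
apply/nbhs_distP; exists e => // y /= xye.
rewrite ltr_norml; have := dist_to_triangle x y A0.
have := dist_to_triangle y x A0; rewrite (distC y x) => h1 h2.
by apply/andP; split; lra.
Qed.

Lemma cvg_dist_to A (u : nat -> X) (l : X) : A !=set0 ->
  u n @[n --> \oo] --> l -> dist_to A (u n) @[n --> \oo] --> dist_to A l.
Proof.
move=> A0 ul; exact: (cvg_comp u (dist_to A) ul (@dist_to_continuous A A0 l)).
Qed.

Lemma dist_to_eq0 A x : closed A -> A !=set0 -> dist_to A x = 0 -> A x.
Proof.
move=> cA A0 d0; apply: cA => B /nbhs_distP[e /= e0 eB].
have [|a Aa xa] := @dist_to_lt A x e A0; first by rewrite d0.
by exists a; split => //; exact: eB.
Qed.

End distance.

(** * Limits of trajectories and compactness from admissibility *)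

Section dynamics.
Context {R : realType} {X : metricType R}.
Implicit Types (phi : Rplus R -> X) (A B K N : set X).
Context (calR : set (Rplus R -> X)).
Hypothesis calR_cont : forall phi, calR phi -> continuous phi.

(** The form in which (K4) is used: one subsequence serves all convergent sequences of times,
    because these eventually lie in the compact segment up to [s + 1]. *)
Lemma limit_trajectory (phi_ : nat -> Rplus R -> X) (x : X) : condK4 calR ->
  (forall n, calR (phi_ n)) -> ev (phi_ n) 0 @[n --> \oo] --> x ->
  exists phi (k : nat -> nat), [/\ calR phi, ev phi 0 = x, increasing_seq k &
    forall (s_ : nat -> R) (s : R), (forall n, 0 <= s_ n) ->
      s_ n @[n --> \oo] --> s ->
      ev (phi_ (k n)) (s_ n) @[n --> \oo] --> ev phi s].
Proof.
move=> hK4 phiR phix; have [phi [Rphi phi0] [k ik ck]] := hK4 _ _ phiR phix.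
exists phi, k; split => // s_ s s0 s_s.
have s_le : \forall n \near \oo, s_ n <= s + 1.
  by apply: (cvgr_le _ s_s); rewrite ltrDl.
apply: (@cvg_ev_uniform _ _ (s + 1) (fun n => phi_ (k n))) => //.
- exact: calR_cont.
- by move/fam_cvgP : ck; apply; exact: compact_initial_segment.
- by apply: filterS s_le => n ->; rewrite s0.
Qed.

Definition stays N phi (t : R) := forall s : R, 0 <= s <= t -> N (ev phi s).

Lemma admissible_cvg N (t_ : nat -> R) (phi_ : nat -> Rplus R -> X) :
  admissible calR N -> (forall n, 0 <= t_ n) -> t_ n @[n --> \oo] --> +oo ->
  (forall n, calR (phi_ n)) -> (forall n, stays N (phi_ n) (t_ n)) ->
  exists2 k : nat -> nat, increasing_seq k &
    exists x : X, ev (phi_ (k n)) (t_ (k n)) @[n --> \oo] --> x.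
Proof.
move=> [_ adm] t0 t_oo phiR phiN.
have [||n s st|k ik [x kx]] := adm (fun n => toRplus (t_ n)) phi_.
- rewrite (_ : (fun n => _) = t_)//.
  by apply/funext => n; exact: toRplusK.
- exact: phiR.
- rewrite -(toRplus_val s); apply: phiN.
  by rewrite Rplus_ge0/= (le_trans st)// toRplusK.
- by exists k => //; exists x.
Qed.

(* Under admissibility this plays the role of the unstable set of N. *)
Definition late_limits N : set X := [set z | forall e T : R, 0 < e -> 0 <= T ->
  exists phi t, [/\ calR phi, T <= t, stays N phi t & dist z (ev phi t) < e]].

Lemma late_limits_cvg N (t_ : nat -> R) (phi_ : nat -> Rplus R -> X) z :
  t_ n @[n --> \oo] --> +oo ->
  (forall n, calR (phi_ n)) -> (forall n, stays N (phi_ n) (t_ n)) ->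
  ev (phi_ n) (t_ n) @[n --> \oo] --> z -> late_limits N z.
Proof.
move=> /cvgryPge t_oo phiR phiN /cvg_distP cz e T e0 T0.
near \oo => n; exists (phi_ n), (t_ n); split => //; first by near: n.
by near: n; exact: cz.
Unshelve. all: by end_near. Qed.

(** A diagonal argument: [x_ n] is close to a late limit, which is close to some [phi_n(t_n)] with
    [n <= t_n], and admissibility makes the latter points subconverge. *)
Lemma late_limits_compact N (x_ : nat -> X) : admissible calR N ->
  late_limits N !=set0 -> dist_to (late_limits N) (x_ n) @[n --> \oo] --> (0 : R) ->
  exists k z, [/\ increasing_seq k, late_limits N z & x_ (k n) @[n --> \oo] --> z].
Proof.
move=> adm L0 xL; pose w n : R := n.+1%:R^-1; have w0 n : 0 < w n by rewrite invr_gt0.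
have h n : exists ap : X * ((Rplus R -> X) * R), [/\ calR ap.2.1, n%:R <= ap.2.2,
    stays N ap.2.1 ap.2.2, dist (x_ n) ap.1 < dist_to (late_limits N) (x_ n) + w n
    & dist ap.1 (ev ap.2.1 ap.2.2) < w n].
  have [|a La xa] := @dist_to_lt _ _ (late_limits N) (x_ n)
    (dist_to (late_limits N) (x_ n) + w n) L0; first by rewrite ltrDl.
  have [//|//|phi [t [Rphi nt phiN at_]]] := La (w n) n%:R.
  by exists (a, (phi, t)).
have [ap apP] := choice h; pose a_ n := (ap n).1; pose phi_ n := (ap n).2.1.
pose t_ n := (ap n).2.2.
have phiR n : calR (phi_ n) by have [] := apP n.
have phiN n : stays N (phi_ n) (t_ n) by have [] := apP n.
have nt n : n%:R <= t_ n by have [] := apP n.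
have t_oo : t_ n @[n --> \oo] --> +oo.
  apply/cvgryPge => M; near=> n; apply: le_trans (nt n).
  by near: n; exact: nbhs_infty_ger.
have [|k ik [z kz]] := admissible_cvg adm _ t_oo phiR phiN.
  by move=> n; exact: le_trans (nt n).
exists k, z; split => //.
  apply: (@late_limits_cvg _ (t_ \o k) (phi_ \o k)) kz => [|n|n] /=.
  - exact: cvg_subseq ik t_oo.
  - exact: phiR.
  - exact: phiN.
have hk : w (k n) @[n --> \oo] --> (0 : R) by exact: cvg_subseq ik cvg_harmonic.
have xLk := cvg_subseq ik xL.
apply/cvg_distP => e e0.
(* Two quarters pay for the distance from [x_] to [a_], one for that from [a_] to the trajectory,
   one for that from the trajectory to [z]. *)
have e40 : 0 < e / 4 by rewrite divr_gt0.
near=> n.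
have [_ _ _ xa at_] := apP (k n).
have h1 : dist z (ev (phi_ (k n)) (t_ (k n))) < e / 4.
  by near: n; move: kz => /cvg_distP; apply.
have h2 : w (k n) < e / 4 by near: n; exact: (cvgr_lt _ hk).
have h3 : dist_to (late_limits N) (x_ (k n)) < e / 4 by near: n; exact: (cvgr_lt _ xLk).
have := dist_trans (ev (phi_ (k n)) (t_ (k n))) z (x_ (k n)).
have := dist_trans (a_ (k n)) (ev (phi_ (k n)) (t_ (k n))) (x_ (k n)).
rewrite (distC _ (a_ (k n))) (distC (a_ (k n)) (x_ (k n))).
move: xa at_ h1 h2 h3; rewrite -/(phi_ _) -/(a_ _) -/(t_ _).
move=> xa at_ h1 h2 h3 h4 h5.
lra.
Unshelve. all: by end_near. Qed.

End dynamics.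

(** * Complete trajectories through late limits *)

Section complete_trajectories.
Context {R : realType} {X : metricType R}.
Implicit Types (phi : Rplus R -> X) (A B K N : set X).
Context (calR : set (Rplus R -> X)).
Hypothesis calR_cont : forall phi, calR phi -> continuous phi.
Hypotheses (hK2 : condK2 calR) (hK3 : condK3 calR) (hK4 : condK4 calR).

Lemma shift_seq_cvg (phi_ : nat -> Rplus R -> X) (tau_ : nat -> R) (x : X) :
  (forall n, calR (phi_ n)) -> (forall n, 0 <= tau_ n) ->
  ev (phi_ n) (tau_ n) @[n --> \oo] --> x ->
  exists phi (k : nat -> nat), [/\ calR phi, ev phi 0 = x, increasing_seq k &
    forall t : R, 0 <= t ->
      ev (phi_ (k n)) (tau_ (k n) + t) @[n --> \oo] --> ev phi t].
Proof.
move=> phiR tau0 taux.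
have [||phi [k [Rphi phi0 ik ck]]] := @limit_trajectory _ _ _ calR_cont
    (fun n => Defs.shift (tau_ n) (phi_ n)) x hK4.
- by move=> n; exact: hK2.
- rewrite (_ : (fun n => _) = (fun n => ev (phi_ n) (tau_ n)))//.
  by apply/funext => n; rewrite ev_shift// addr0.
- exists phi, k; split => // t t0.
  have := ck (fun=> t) t (fun=> t0) (cvg_cst _).
  have e n : ev (Defs.shift (tau_ (k n)) (phi_ (k n))) t =
    ev (phi_ (k n)) (tau_ (k n) + t) by rewrite ev_shift.
  by rewrite (eq_cvg _ _ e); apply.
Qed.

(** Stop the approximating trajectories one unit of time earlier: by admissibility those points
    subconverge to a late limit, and the limit trajectory from there reaches [z] at time 1. *)
Lemma late_limits_pred N z : admissible calR N -> late_limits calR N z ->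
  exists phi, [/\ calR phi, late_limits calR N (ev phi 0), ev phi 1 = z &
    stays N phi 1].
Proof.
move=> adm Lz; pose w n : R := n.+1%:R^-1; have w0 n : 0 < w n by rewrite invr_gt0.
have /choice[pt ptP] : forall n, exists pt : (Rplus R -> X) * R, [/\ calR pt.1,
    n.+1%:R <= pt.2, stays N pt.1 pt.2 & dist z (ev pt.1 pt.2) < w n].
  move=> n; have [//|//|phi [t [Rphi nt phiN zt]]] := Lz (w n) n.+1%:R.
  by exists (phi, t).
pose phi_ n := (pt n).1; pose t_ n := (pt n).2 - 1.
have phiR n : calR (phi_ n) by have [] := ptP n.
have nt n : n%:R <= t_ n by have [_ + _ _] := ptP n; rewrite lerBrDr -natr1.
have t0 n : 0 <= t_ n by exact: le_trans (nt n).
have phiN n : stays N (phi_ n) (t_ n + 1).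
  by rewrite subrK; have [] := ptP n.
have zt n : dist z (ev (phi_ n) (t_ n + 1)) < w n.
  by rewrite subrK; have [] := ptP n.
have phiN' n : stays N (phi_ n) (t_ n).
  by move=> s /andP[s0 st]; apply: phiN; rewrite s0 (le_trans st)// lerDl.
have t_oo : t_ n @[n --> \oo] --> +oo.
  apply/cvgryPge => M; near=> n; apply: le_trans (nt n).
  by near: n; exact: nbhs_infty_ger.
have [k ik [y ky]] := admissible_cvg adm t0 t_oo phiR phiN'.
have [phi [k' [Rphi phi0 ik' ck']]] :=
  @shift_seq_cvg (phi_ \o k) (t_ \o k) y (fun=> phiR _) (fun=> t0 _) ky.
exists phi; split => //.
- rewrite phi0; apply: (@late_limits_cvg _ _ _ N (t_ \o k) (phi_ \o k)) => //.
  + exact: cvg_subseq ik t_oo.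
  + by move=> n; exact: phiR.
  + by move=> n; exact: phiN'.
- apply: (cvg_unique (@metric_hausdorff _ _) (ck' 1 ler01)).
  apply/cvg_distP => e e0; have ikk' := increasing_seq_comp ik ik'.
  have wk : w (k (k' n)) @[n --> \oo] --> (0 : R).
    exact: cvg_subseq ikk' cvg_harmonic.
  near=> n; apply: (lt_trans (zt _)).
  by near: n; exact: (cvgr_lt _ wk).
- move=> s /andP[s0 s1]; apply: (closed_lim adm.1 _ (ck' s s0)); apply: nearW => n.
  apply: phiN => /=.
  by rewrite addr_ge0//= lerD2l.
Unshelve. all: by end_near. Qed.

(* Trajectories in N are prepended one unit of time after another. *)
Lemma late_limits_complete N phi : admissible calR N ->
  late_limits calR N (ev phi 0) -> calR phi ->
  (forall t : R, 0 <= t -> N (ev phi t)) ->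
  exists psi : R -> X, [/\ complete_trajectory calR psi, psi 0 = ev phi 0 &
    forall t, N (psi t)].
Proof.
move=> adm Lphi Rphi Nphi.
have /choice[pr prP] : forall z, exists chi, late_limits calR N z ->
    [/\ calR chi, late_limits calR N (ev chi 0), ev chi 1 = z & stays N chi 1].
  move=> z; have [Lz|nLz] := pselect (late_limits calR N z); last by exists phi.
  by have [chi chiP] := late_limits_pred adm Lz; exists chi.
(* [C j] is [phi] preceded by [j] units of past, so its time 0 is time [-j] of the complete
   trajectory. *)
pose C := fix C j := if j is j'.+1 then
  let c := C j' in concat 1 (pr (ev c 0)) c else phi.
have CP j : [/\ calR (C j), late_limits calR N (ev (C j) 0) &
    forall t : R, 0 <= t -> N (ev (C j) t)].
  elim: j => [//|j [RC LC NC]] /=.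
  have [Rp Lp p1 Np] := prP _ LC; split.
  - exact: hK3.
  - by rewrite ev_concat_le// lexx ler01.
  - move=> t t0; have [t1|t1] := leP t 1.
      by rewrite ev_concat_le ?t0//; apply: Np; rewrite t0.
    rewrite (_ : t = 1 + (t - 1)); last by rewrite addrC subrK.
    by rewrite ev_concat_ge ?subr_ge0 ?(ltW t1)//; apply: NC; rewrite subr_ge0 ltW.
have CS j t : 0 <= t -> ev (C j.+1) (1 + t) = ev (C j) t.
  move=> t0; have [_ LC _] := CP j; have [_ _ p1 _] := prP _ LC.
  by rewrite /= ev_concat_ge.
have CD i j t : 0 <= t -> ev (C (i + j)%N) (i%:R + t) = ev (C j) t.
  elim: i => [|i IH] t0; first by rewrite add0r.
  by rewrite addSn -nat1r -addrA CS ?addr_ge0// IH.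
(* [b t] units of past reach back beyond [t]; [psiE] shows that any sufficient number of units gives
   the same value. *)
pose b (t : R) := Num.bound `|t|; pose psi t := ev (C (b t)) ((b t)%:R + t).
have bd t : 0 <= (b t)%:R + t.
  by have := archi_boundP (normr_ge0 t); rewrite -/(b t) ltr_norml => /andP[+ _]; lra.
have psiE j t : 0 <= j%:R + t -> psi t = ev (C j) (j%:R + t).
  move=> jt; rewrite /psi -(CD j _ _ (bd t)) -(CD (b t) _ _ jt).
  by rewrite addnC addrCA.
exists psi; split.
- move=> tau; have [RC _ _] := CP (b tau).
  rewrite (_ : (fun _ => _) = Defs.shift ((b tau)%:R + tau) (C (b tau))).
    exact: hK2.
  apply/funext => t; rewrite (psiE (b tau)) ?addrA//.
  by rewrite addr_ge0// Rplus_ge0.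
- by rewrite (psiE 0%N) ?add0r ?addr0.
- by move=> t; have [_ _] := CP (b t); exact.
Qed.

End complete_trajectories.

(** * Compactness and maximality of [K] *)

Section isolated.
Context {R : realType} {X : metricType R}.
Implicit Types (phi : Rplus R -> X) (A B : set X).
Context (calR : set (Rplus R -> X)) (K N : set X).
Hypothesis calR_cont : forall phi, calR phi -> continuous phi.
Hypotheses (hK2 : condK2 calR) (hK3 : condK3 calR) (hK4 : condK4 calR).
Hypotheses (K_nonempty : K !=set0) (K_closed : closed K).
Hypothesis N_isolating : isolating_neighborhood calR K N.
Hypothesis N_admissible : admissible calR N.

Let L := late_limits calR N.

Lemma isolated_subset : K `<=` N.
Proof. by case: N_isolating => _ _ []. Qed.

Let K_weakly_invariant : weakly_invariant calR K.
Proof. by case: N_isolating => _ _ []. Qed.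

Lemma isolated_forward x : K x -> exists phi, [/\ calR phi, ev phi 0 = x &
  forall t : R, 0 <= t -> K (ev phi t)].
Proof.
move=> /K_weakly_invariant[psi [cpsi psi0 Kpsi]].
have e (t : R) : 0 <= t -> 0 + val (toRplus t) = t by move=> /toRplusK ->; rewrite add0r.
exists (fun t => psi (0 + val t)); split; first exact: cpsi.
- by rewrite e.
- by move=> t t0; rewrite e//; apply: Kpsi; exists t.
Qed.

(** A complete trajectory in [K] supplies a past of any length [T] inside [N], and (K3) glues it in
    front of [phi]. *)
Lemma late_limits_from_isolated phi (t : R) : calR phi -> K (ev phi 0) -> 0 <= t ->
  stays N phi t -> L (ev phi t).
Proof.
move=> Rphi /K_weakly_invariant[psi [cpsi psi0 Kpsi]] t0 phiN e T e0 T0.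
pose theta : Rplus R -> X := fun s => psi (- T + val s).
have eT : ev theta T = ev phi 0 by rewrite /theta toRplusK// addNr.
have ec : ev (concat T theta phi) (T + t) = ev phi t by exact: ev_concat_ge.
exists (concat T theta phi), (T + t); split.
- by apply: hK3 => //; exact: cpsi.
- by rewrite lerDl.
- move=> s /andP[s0 sTt]; have [sT|Ts] := leP s T.
    rewrite ev_concat_le ?s0//; apply: isolated_subset; apply: Kpsi.
    by exists (- T + val (toRplus s)).
  rewrite (_ : s = T + (s - T)); last by rewrite addrC subrK.
  rewrite ev_concat_ge ?subr_ge0 ?(ltW Ts)//; apply: phiN.
  by rewrite subr_ge0 (ltW Ts) lerBlDl.
- by rewrite ec distxx.
Qed.

Lemma isolated_late x : K x -> L x.
Proof.
move=> /isolated_forward[phi [Rphi <- Kphi]].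
apply: late_limits_from_isolated => //; first exact: Kphi.
by move=> s /andP[s0 _]; apply: isolated_subset; exact: Kphi.
Qed.

(** The point lies on a complete trajectory in [N], whose range is weakly invariant; maximality of
    [K] applies to that range. *)
Lemma late_limits_isolated phi : calR phi -> L (ev phi 0) ->
  (forall t : R, 0 <= t -> N (ev phi t)) -> K (ev phi 0).
Proof.
move=> Rphi Lphi Nphi.
have [psi [cpsi <- Npsi]] :=
  late_limits_complete calR_cont hK2 hK3 hK4 N_admissible Lphi Rphi Nphi.
have [_ _ [_ _ maxK]] := N_isolating.
apply: (maxK (range psi)); last by exists 0.
  move=> _ [s _ <-]; exists (fun t => psi (s + t)); split.
  - move=> tau; have := cpsi (s + tau).
    by congr calR; apply/funext => t; rewrite addrA.
  - by rewrite addr0.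
  - by move=> _ [t _ <-]; exists (s + t).
by move=> _ [s _ <-].
Qed.

(** Since [K] lies in [L], the distance to [L] also tends to 0, and the compactness of late limits
    carries over to the closed set [K]. *)
Lemma isolated_compact (x_ : nat -> X) :
  dist_to K (x_ n) @[n --> \oo] --> (0 : R) ->
  exists k z, [/\ increasing_seq k, K z & x_ (k n) @[n --> \oo] --> z].
Proof.
move=> xK.
have L0 : L !=set0 by case: K_nonempty => x /isolated_late; exists x.
have [|k [z [ik Lz kz]]] := @late_limits_compact _ _ _ N x_ N_admissible L0.
  apply: (@squeeze_cvgr _ _ _ _ (fun=> 0) (fun n => dist_to K (x_ n))) => //.
    apply: nearW => n; rewrite dist_to_ge0 /=; apply/ler_addgt0Pr => e e0.
    have [|a Ka xa] := @dist_to_lt _ _ K (x_ n) (dist_to K (x_ n) + e) K_nonempty.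
      by rewrite ltrDl.
    by rewrite (le_trans (dist_to_le _ (isolated_late Ka)))// ltW.
  exact: cvg_cst.
exists k, z; split => //; apply: dist_to_eq0 => //.
have h1 : dist_to K (x_ (k n)) @[n --> \oo] --> dist_to K z.
  exact: cvg_dist_to kz.
exact: (cvg_unique (@Rhausdorff R) h1 (cvg_subseq ik xK)).
Qed.

Lemma isolated_tube (U : set X) : open U -> K `<=` U ->
  exists2 r : R, 0 < r & forall x, dist_to K x <= r -> U x.
Proof.
move=> oU KU; apply: contrapT => h; pose w n : R := n.+1%:R^-1.
have /choice[x_ x_P] : forall n, exists x, dist_to K x <= w n /\ ~ U x.
  move=> n; apply: contrapT => hn; apply: h.
  exists (w n); first by rewrite invr_gt0.
  by move=> x xw; apply: contrapT => Ux; apply: hn; exists x.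
have [|k [z [ik Kz kz]]] := @isolated_compact x_.
  apply: (@squeeze_cvgr _ _ _ _ (fun=> 0) w) => //.
  - by apply: nearW => n; rewrite dist_to_ge0; have [] := x_P n.
  - exact: cvg_cst.
  - exact: cvg_harmonic.
have cU : closed (~` U) by rewrite closedC.
have /= := closed_lim cU (nearW _ (fun n => (x_P (k n)).2)) kz.
by apply; exact: KU.
Qed.

(* No trajectory near K leaves the rho-tube and still stays in N forever: in
   the limit it would be a homoclinic excursion from K, hence part of K. *)
Lemma isolated_no_excursion (rho : R) : 0 < rho ->
  exists2 delta : R, 0 < delta & forall phi, calR phi ->
    dist_to K (ev phi 0) < delta -> (forall t : R, 0 <= t -> N (ev phi t)) ->
    forall t : R, 0 <= t -> dist_to K (ev phi t) <= rho.
Proof.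
move=> rho0; apply: contrapT => h; pose w n : R := n.+1%:R^-1.
have /choice[pt ptP] : forall n, exists pt : (Rplus R -> X) * R, [/\ calR pt.1,
    dist_to K (ev pt.1 0) < w n, forall t : R, 0 <= t -> N (ev pt.1 t), 0 <= pt.2 &
    rho < dist_to K (ev pt.1 pt.2)].
  move=> n; apply: contrapT => hn; apply: h.
  exists (w n); first by rewrite invr_gt0.
  move=> phi Rphi phiw Nphi t t0; rewrite leNgt; apply/negP => rt.
  by apply: hn; exists (phi, t).
pose phi_ n := (pt n).1; pose t_ n := (pt n).2.
have phiR n : calR (phi_ n) by have [] := ptP n.
have phiN n t : 0 <= t -> N (ev (phi_ n) t) by have [_ _ + _ _] := ptP n; exact.
have t0 n : 0 <= t_ n by have [] := ptP n.
have dK0 : dist_to K (ev (phi_ n) 0) @[n --> \oo] --> (0 : R).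
  apply: (@squeeze_cvgr _ _ _ _ (fun=> 0) w) => //.
  - by apply: nearW => n; rewrite dist_to_ge0 ltW//; have [] := ptP n.
  - exact: cvg_cst.
  - exact: cvg_harmonic.
(* Such a limit point belongs to [K], yet its distance to [K] is at least [rho]. *)
suff [phi [k [Rphi Lphi kphi Nphi]]] : exists phi (k : nat -> nat),
    [/\ calR phi, L (ev phi 0),
    ev (phi_ (k n)) (t_ (k n)) @[n --> \oo] --> ev phi 0 &
    forall t : R, 0 <= t -> N (ev phi t)].
  have Kphi := late_limits_isolated Rphi Lphi Nphi.
  have h1 : dist_to K (ev (phi_ (k n)) (t_ (k n))) @[n --> \oo] --> dist_to K (ev phi 0).
    exact: cvg_dist_to kphi.
  have : rho <= dist_to K (ev phi 0).
    apply: (cvgr_to_ge h1); apply: nearW => n; apply: ltW.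
    by have [] := ptP (k n).
  by rewrite dist_to0// leNgt rho0.
(* If the excursion times tend to infinity, admissibility yields a limit point, which is a late
   limit by definition. *)
have [[k ik kt]|[k ik [t t0' kt]]] := cvg_to_or_infty t0.
  have [||||k' ik' [z zP]] :=
    @admissible_cvg _ _ calR N (t_ \o k) (phi_ \o k) N_admissible.
  - by move=> n; exact: t0.
  - exact: kt.
  - by move=> n; exact: phiR.
  - by move=> n s /andP[s0 _]; exact: phiN.
  have [|||phi [k'' [Rphi phi0 ik'' ck]]] := @shift_seq_cvg _ _ _ calR_cont hK2 hK4
    (phi_ \o k \o k') (t_ \o k \o k') z.
  - by move=> n; exact: phiR.
  - by move=> n; exact: t0.
  - exact: zP.
  exists phi, (k \o k' \o k''); split => //.
  - rewrite phi0; apply: (@late_limits_cvg _ _ _ N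
      (t_ \o k \o k') (phi_ \o k \o k')) => //.
    + exact: cvg_subseq ik' kt.
    + by move=> n; exact: phiR.
    + by move=> n s /andP[s0 _]; exact: phiN.
  - by rewrite phi0; exact: (cvg_subseq ik'' zP).
  - move=> s s0; apply: (closed_lim N_admissible.1 _ (ck s s0)); apply: nearW => n.
    by apply: phiN; rewrite addr_ge0//; exact: t0.
(* If they converge to [t], the initial points subconverge into [K], and the limit trajectory from
   there is in [L] at time [t]. *)
have [k1 [x [ik1 Kx k1x]]] := isolated_compact (cvg_subseq ik dK0).
have [||phi [k2 [Rphi phi0 ik2 ck]]] := @limit_trajectory _ _ _ calR_cont
  (phi_ \o k \o k1) x hK4.
- by move=> n; exact: phiR.
- exact: k1x.
have Nphi s : 0 <= s -> N (ev phi s).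
  move=> s0.
  apply: (closed_lim N_admissible.1 _ (ck (fun=> s) s (fun=> s0) (cvg_cst _))).
  apply: nearW => n.
  exact: phiN.
have e0 : ev (Defs.shift t phi) 0 = ev phi t by rewrite ev_shift// addr0.
exists (Defs.shift t phi), (k \o k1 \o k2); split; first exact: hK2.
- rewrite e0; apply: late_limits_from_isolated => //; first by rewrite phi0.
  by move=> s /andP[s0 _]; exact: Nphi.
- rewrite e0; apply: (ck (t_ \o k \o k1 \o k2)); first by move=> n; exact: t0.
  exact: cvg_subseq (increasing_seq_comp ik1 ik2) kt.
- by move=> s s0; rewrite ev_shift//; apply: Nphi; rewrite addr_ge0.
Qed.

End isolated.

(** * Sequential tests for open and closed sets *)

Section sequential.
Context {R : realType} {X : metricType R}.

(** One index in [U] suffices, because the test sequence lies entirely outside [U]. *)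
Lemma open_sequential (U : set X) :
  (forall x (u : nat -> X), U x -> u n @[n --> \oo] --> x -> exists n, U (u n)) ->
  open U.
Proof.
move=> seqU; rewrite openE => x Ux; rewrite /interior.
apply: contrapT => nU; pose w n : R := n.+1%:R^-1.
have /choice[u uP] : forall n, exists y, dist x y < w n /\ ~ U y.
  move=> n; apply: contrapT => hn; apply: nU; apply/nbhs_distP.
  exists (w n); first by rewrite invr_gt0.
  by move=> y xy; apply: contrapT => Uy; apply: hn; exists y.
have [|n Un] := seqU x u Ux; last exact: (uP n).2.
apply/cvg_distP => e e0; near=> n; apply: lt_trans (uP n).1 _.
by near: n; exact: (cvgr_lt _ cvg_harmonic).
Unshelve. all: by end_near. Qed.

Lemma closed_sequential (A : set X) :
  (forall x (u : nat -> X), (forall n, A (u n)) -> u n @[n --> \oo] --> x -> A x) ->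
  closed A.
Proof.
move=> seqA; rewrite -[A]setCK closedC; apply: open_sequential => x u Ax ux.
apply: contrapT => h; apply: Ax; apply: seqA ux => n.
by apply: contrapT => Aun; apply: h; exists n.
Qed.

End sequential.

(** * The increasing time weight *)

Section alpha.
Context {R : realType}.

Definition alpha (t : R) : R := 2 - (1 + t)^-1.

Lemma alpha_bounds (t : R) : 0 <= t -> 1 <= alpha t < 2.
Proof.
move=> t0; have t10 : 0 < 1 + t by lra.
have : 0 < (1 + t)^-1 by rewrite invr_gt0.
have : (1 + t)^-1 <= 1 by rewrite invf_le1// lerDl.
by rewrite /alpha => *; apply/andP; split; lra.
Qed.

Lemma alpha0 : alpha 0 = 1.
Proof. by rewrite /alpha addr0 invr1; lra. Qed.

Lemma alpha_increasing (s t : R) : 0 <= s -> s < t -> alpha s < alpha t.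
Proof.
move=> s0 st; rewrite /alpha ltrD2l ltrN2 ltf_pV2 ?posrE ?ltrD2l//; lra.
Qed.

Lemma cvg_alpha (t_ : nat -> R) (t : R) : 0 <= t -> t_ n @[n --> \oo] --> t ->
  alpha (t_ n) @[n --> \oo] --> alpha t.
Proof.
move=> t0 tt; apply: cvgB; first exact: cvg_cst.
apply: cvgV; first by rewrite gt_eqF//; lra.
by apply: cvgD => //; exact: cvg_cst.
Qed.

Lemma alpha_ge (a : R) : a < 2 -> exists2 t : R, 0 <= t & a <= alpha t.
Proof.
(* The equation [alpha t = a] has the solution [(2 - a)^-1 - 1]; dropping the [- 1] keeps the
   witness nonnegative. *)
move=> a2; exists (2 - a)^-1; first by rewrite invr_ge0; lra.
have h : 0 < (2 - a)^-1 by rewrite invr_gt0; lra.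
suff : (1 + (2 - a)^-1)^-1 <= 2 - a by rewrite /alpha; lra.
by rewrite -[leRHS]invrK lef_pV2 ?posrE//; lra.
Qed.

End alpha.

(** * The values defining [Z_F]: monotonicity, semicontinuity, localisation *)

Section attains.
Context {R : realType} {X : metricType R}.
Implicit Types (phi : Rplus R -> X) (F : X -> R).
Context (calR : set (Rplus R -> X)) (K N : set X) (rho : R).
Hypothesis calR_cont : forall phi, calR phi -> continuous phi.
Hypotheses (hK2 : condK2 calR) (hK3 : condK3 calR) (hK4 : condK4 calR).
Hypotheses (K_nonempty : K !=set0) (K_closed : closed K).
Hypothesis N_isolating : isolating_neighborhood calR K N.
Hypothesis N_admissible : admissible calR N.
Hypothesis rho_gt0 : 0 < rho.
Hypothesis tubeN : forall x, dist_to K x <= 2 * rho -> N x.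

Let L := late_limits calR N.

Definition tube phi (t c : R) :=
  forall s : R, 0 <= s <= t -> dist_to K (ev phi s) <= (2 - c) * rho.

(* v is one of the values whose supremum is Z_F(x); the supremum itself is never
   needed, and [2 - c] makes c = 1 the inner tube and c = 0 the outer one. *)
Definition attains F (x : X) (v : R) := exists phi t c,
  [/\ calR phi, ev phi 0 = x, 0 <= t, 0 <= c <= 1 &
    tube phi t c /\ v = c * alpha t * F (ev phi t)].

Lemma tube_subset phi t c : 0 <= c -> tube phi t c -> stays N phi t.
Proof.
move=> c0 tub s st; apply: tubeN; apply: le_trans (tub s st) _.
by rewrite ler_pM2r//; lra.
Qed.

(** For [F = dist_to L] this makes every value attained from a point of [K] zero. *)
Lemma attains_late F x v : K x -> attains F x v -> exists2 y, L y & exists c, v = c * F y.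
Proof.
move=> Kx [phi [t [c [Rphi phi0 t0 /andP[c0 c1] [tub ->]]]]].
exists (ev phi t); last by exists (c * alpha t).
apply: (late_limits_from_isolated hK3 N_isolating) => //; first by rewrite phi0.
exact: tube_subset tub.
Qed.

(** Gluing the segment of [phi] in front keeps the endpoint and lengthens the time. The segment lies
    in the inner tube, so the same [c] is allowed, and [0 < v] makes the growth of [alpha] a strict
    gain. *)
Lemma attains_strict F phi (s v : R) : calR phi -> 0 < s ->
  (forall u, 0 <= u <= s -> dist_to K (ev phi u) <= rho) ->
  attains F (ev phi s) v -> 0 < v -> exists2 v', v < v' & attains F (ev phi 0) v'.
Proof.
move=> Rphi s0 phir [psi [t [c [Rpsi psi0 t0 /andP[c0 c1] [tub ->]]]]] v0.
have at1 : 1 <= alpha t by case/andP: (alpha_bounds t0).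
have cF0 : 0 < c * F (ev psi t).
  move: v0; rewrite mulrAC pmulr_lgt0//; lra.
have ec : ev (concat s phi psi) (s + t) = ev psi t.
  by rewrite ev_concat_ge ?(ltW s0)// psi0.
exists (c * alpha (s + t) * F (ev psi t)).
  by rewrite (mulrAC c (alpha t)) (mulrAC c (alpha (s + t))) ltr_pM2l//
     alpha_increasing// ltrDr.
exists (concat s phi psi), (s + t), c; split => //.
- by apply: hK3 => //; exact: ltW.
- by rewrite ev_concat_le// lexx ltW.
- by rewrite addr_ge0// ltW.
- by rewrite c0.
- rewrite ec; split => // u /andP[u0 ust]; have [us|su] := leP u s.
    rewrite ev_concat_le ?u0// (le_trans (phir u _)) ?u0//.
    by rewrite -[leLHS]mul1r ler_pM2r//; lra.
  rewrite (_ : u = s + (u - s)); last by rewrite addrC subrK.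
  rewrite ev_concat_ge ?subr_ge0 ?(ltW s0) ?(ltW su)//.
  by apply: tub; rewrite subr_ge0 ltW//= lerBlDl.
Qed.

(** Upper semicontinuity for convergent times: (K4) gives the limit path, and boundedness of [c_] a
    limit factor. *)
Lemma attains_limit F (a : R) (x : X) (phi_ : nat -> Rplus R -> X)
    (t_ c_ : nat -> R) (t : R) : continuous F ->
  (forall n, calR (phi_ n)) -> (forall n, 0 <= t_ n) ->
  (forall n, 0 <= c_ n <= 1) -> (forall n, tube (phi_ n) (t_ n) (c_ n)) ->
  (forall n, a <= c_ n * alpha (t_ n) * F (ev (phi_ n) (t_ n))) ->
  ev (phi_ n) 0 @[n --> \oo] --> x -> t_ n @[n --> \oo] --> t ->
  exists2 v, a <= v & attains F x v.
Proof.
move=> cF phiR t0 c01 tub av phix tt.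
have tge0 : 0 <= t by apply: (cvgr_to_ge tt); exact: nearW.
have c0 n : 0 <= c_ n by case/andP: (c01 n).
have [[k0 ik0 kc]|[k ik [c _ kc]]] := cvg_to_or_infty c0.
  exfalso; move/cvgryPge : kc => /(_ 2) kc.
  near \oo => n; have /andP[_] := c01 (k0 n); apply/negP; rewrite -ltNge.
  by apply: (@lt_le_trans _ _ 2); [rewrite ltr1n|near: n].
have [||phi [k' [Rphi phi0 ik' ck]]] :=
  @limit_trajectory _ _ _ calR_cont (phi_ \o k) x hK4.
- by move=> n; exact: phiR.
- exact: cvg_subseq ik phix.
pose p := k \o k'; have ip : increasing_seq p := increasing_seq_comp ik ik'.
have pt : t_ (p n) @[n --> \oo] --> t by exact: cvg_subseq ip tt.
have pc : c_ (p n) @[n --> \oo] --> c by exact: cvg_subseq ik' kc.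
have pphi : ev (phi_ (p n)) (t_ (p n)) @[n --> \oo] --> ev phi t.
  by apply: (ck (t_ \o p)) => // n; exact: t0.
exists (c * alpha t * F (ev phi t)).
  have h : c_ (p n) * alpha (t_ (p n)) * F (ev (phi_ (p n)) (t_ (p n))) @[n --> \oo]
      --> c * alpha t * F (ev phi t).
    apply: cvgM; first by apply: cvgM => //; exact: cvg_alpha.
    exact: (cvg_comp (fun n => ev (phi_ (p n)) (t_ (p n))) F pphi (cF _)).
  by apply: (cvgr_to_ge h); apply: nearW => n; exact: av.
exists phi, t, c; split => //.
  apply/andP; split; first by apply: (cvgr_to_ge pc); apply: nearW => n; exact: c0.
  by apply: (cvgr_to_le pc); apply: nearW => n; have /andP[_] := c01 (p n).
split => // s /andP[s0 st].
(* The time [s] may exceed [t_ (p n)], where the tube condition says nothing; the truncated time is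
   covered by it and still tends to [s]. *)
have ms : Num.min s (t_ (p n)) @[n --> \oo] --> s.
  rewrite -[X in _ --> X](min_l st).
  have cmin : {for t, continuous (fun y : R => Num.min s y)}.
    by apply: (@continuous_min _ _ (fun=> s) id); [exact: cvg_cst|exact: cvg_id].
  exact: (cvg_comp (fun n => t_ (p n)) (fun y => Num.min s y) pt cmin).
have msphi : ev (phi_ (p n)) (Num.min s (t_ (p n))) @[n --> \oo] --> ev phi s.
  by apply: (ck (fun n => Num.min s (t_ (p n)))) => // n; rewrite le_min s0 t0.
have h1 := cvg_dist_to K_nonempty msphi.
have h2 : (2 - c_ (p n)) * rho @[n --> \oo] --> (2 - c) * rho.
  by apply: cvgM; [apply: cvgB => //|]; exact: cvg_cst.
rewrite -subr_ge0; apply: (cvgr_to_ge (cvgB h2 h1)); apply: nearW => n /=.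
by rewrite subr_ge0; apply: tub; rewrite le_min s0 t0 ge_min lexx orbT.
Unshelve. all: by end_near. Qed.


(** The last clause of (K5) for a fixed open set [O]. *)
Definition trajectories_lsc (O : set X) := forall (x : X) phi (x_ : nat -> X),
  O x -> calR phi -> ev phi 0 = x -> x_ n @[n --> \oo] --> x ->
  exists (k : nat -> nat) (phi_ : nat -> Rplus R -> X),
    [/\ increasing_seq k,
        forall n, calR (phi_ n) /\ ev (phi_ n) 0 = x_ (k n) &
        {family [set C : set (Rplus R) | compact C /\
                   forall t, C t -> ((val t)%:E < exit_time O phi)%E],
          phi_ n @[n --> \oo] --> phi}].

(** Lower semicontinuity: lowering [c] slightly keeps the value above [a] and widens the tube, which
    leaves room for the approximating paths of (K5). *)
Lemma attains_open F (a : R) (O : set X) :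
  open O -> (forall x, dist_to K x < 2 * rho -> O x) ->
  trajectories_lsc O ->
  continuous F -> 0 <= a -> open [set x | exists2 v, a < v & attains F x v].
Proof.
move=> oO tubeO K5 cF a0; apply: open_sequential => x x_ /= [v av].
move=> [phi [t [c [Rphi phi0 t0 /andP[c0 c1] [tub vE]]]]] xx.
pose m := alpha t * F (ev phi t).
have cm : a < c * m by rewrite mulrA -vE.
have {}c0 : 0 < c.
  by rewrite lt_neqAle c0 andbT; apply/eqP => c00; move: cm; rewrite -c00; lra.
have m0 : 0 < m by rewrite -(pmulr_rgt0 _ c0); lra.
have am : a / m < c by rewrite ltr_pdivrMr.
have am0 : 0 <= a / m by rewrite divr_ge0// ltW.
(* The midpoint between [c] and the factor [a / m] at which the value would drop to [a]. *)
pose c' := (c + a / m) / 2.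
have c'c : c' < c by rewrite /c'; lra.
have c'0 : 0 < c' by rewrite /c'; lra.
have ac' : a < c' * m by rewrite -ltr_pdivrMr// /c'; lra.
have Otub s : 0 <= s <= t -> dist_to K (ev phi s) < 2 * rho.
  by move=> /tub/le_lt_trans; apply; rewrite ltr_pM2r//; lra.
(* (K5) gives convergence only strictly before the exit time, so the path has to remain in [O] a
   little beyond [t]. *)
have [e e0 phie] : exists2 e : R, 0 < e &
    forall s, t <= s <= t + e -> dist_to K (ev phi s) < 2 * rho.
  have cd : (fun s => dist_to K (ev phi s)) @ t --> dist_to K (ev phi t).
    apply: (@continuous_comp _ _ _ (fun s : R => ev phi s) (dist_to K)).
      exact: ev_continuous (calR_cont Rphi) _.
    exact: dist_to_continuous.
  have : \forall s \near t, dist_to K (ev phi s) < 2 * rho.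
    by apply: (cvgr_lt _ cd); apply: Otub; rewrite t0 lexx.
  move=> /nbhs_ballP[e /= e0 he]; exists (e / 2); first by rewrite divr_gt0.
  move=> s /andP[ts ste]; apply: he; rewrite /ball /= ler0_norm; lra.
have Ox : O x by rewrite -phi0; apply/tubeO/Otub; rewrite lexx t0.
have [k [phi_ [ik phiP fphi]]] := K5 x phi x_ Ox Rphi phi0 xx.
have uphi : {uniform [set s | val s <= t], phi_ n @[n --> \oo] --> phi}.
  move/fam_cvgP : fphi; apply; split; first exact: compact_initial_segment.
  move=> s /= st; apply: (@lt_le_trans _ _ (t + e)%:E).
    by rewrite lte_fin (le_lt_trans st)// ltrDl.
  apply: ereal_sup_ubound; exists (toRplus (t + e)); last first.
    by rewrite toRplusK// addr_ge0// ltW.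
  move=> u /=; rewrite (max_idPr _) ?addr_ge0 ?(ltW e0)// => ute.
  rewrite -(toRplus_val u); apply: tubeO; have u0 := Rplus_ge0 u.
  have [ut|tu] := leP (val u) t; first by apply: Otub; rewrite u0.
  by apply: phie; rewrite (ltW tu).
have Fphi : F (ev (phi_ n) t) @[n --> \oo] --> F (ev phi t).
  have tphi : ev (phi_ n) t @[n --> \oo] --> ev phi t.
    apply: (@cvg_ev_uniform _ _ t _ _ (fun=> t)) => //; first exact: calR_cont.
      by apply: nearW => n; rewrite t0 lexx.
    exact: cvg_cst.
  exact: (cvg_comp (fun n => ev (phi_ n) t) F tphi (cF _)).
have vphi : c' * alpha t * F (ev (phi_ n) t) @[n --> \oo] --> c' * m.
  by rewrite /m mulrA; apply: cvgM => //; exact: cvg_cst.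
have eta0 : 0 < (c - c') * rho by rewrite mulr_gt0//; lra.
have h1 := cvg_uniform_dist uphi eta0.
have h2 := cvgr_gt _ vphi _ ac'.
near \oo => n; exists (k n), (c' * alpha t * F (ev (phi_ n) t)).
  by near: n; exact: h2.
have [Rn n0] := phiP n.
exists (phi_ n), t, c'; split => //; first by apply/andP; split; lra.
split => // s /andP[s0 st].
have h3 : forall u : Rplus R, val u <= t -> dist (phi u) (phi_ n u) < (c - c') * rho.
  by near: n; exact: h1.
have {}h3 := h3 (toRplus s); rewrite toRplusK// in h3; have {}h3 := h3 st.
have := tub s; rewrite s0 st => /(_ isT) h4.
have := dist_to_triangle (ev (phi_ n) s) (ev phi s) K_nonempty.
by rewrite distC; lra.
Unshelve. all: by end_near. Qed.

(** If the times tended to infinity, the endpoints would subconverge into [L]; but their distance to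
    [L] is at least [a / 2], as [c * alpha t <= 2]. So some subsequence of times converges. *)
Lemma attains_late_closed (a : R) : 0 < a ->
  closed [set x | exists2 v, a <= v & attains (dist_to L) x v].
Proof.
move=> a0.
have L0 : L !=set0.
  by case: K_nonempty => x Kx; exists x; apply: isolated_late N_isolating _ Kx.
apply: closed_sequential => x x_ /= xP xx.
have /choice[p pP] : forall n, exists p : (Rplus R -> X) * (R * R), [/\ calR p.1,
    ev p.1 0 = x_ n, 0 <= p.2.1, 0 <= p.2.2 <= 1 & tube p.1 p.2.1 p.2.2 /\
    a <= p.2.2 * alpha p.2.1 * dist_to L (ev p.1 p.2.1)].
  move=> n; have [v av [phi [t [c [Rphi phi0 t0 c01 [tub vE]]]]]] := xP n.
  by exists (phi, (t, c)); split => //=; rewrite -vE.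
pose phi_ n := (p n).1; pose t_ n := (p n).2.1; pose c_ n := (p n).2.2.
have phiR n : calR (phi_ n) by have [] := pP n.
have phi0 n : ev (phi_ n) 0 = x_ n by have [] := pP n.
have t0 n : 0 <= t_ n by have [] := pP n.
have c01 n : 0 <= c_ n <= 1 by have [] := pP n.
have tub n : tube (phi_ n) (t_ n) (c_ n) by have [_ _ _ _ []] := pP n.
have av n : a <= c_ n * alpha (t_ n) * dist_to L (ev (phi_ n) (t_ n)).
  by have [_ _ _ _ []] := pP n.
have [[k ik kt]|[k ik [t _ kt]]] := cvg_to_or_infty t0; last first.
  apply: (@attains_limit _ a x (phi_ \o k) (t_ \o k) (c_ \o k) t) => //=.
  - exact: dist_to_continuous.
  - by rewrite (eq_cvg _ _ (fun n => phi0 (k n))); exact: cvg_subseq ik xx.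
exfalso.
have stN n : stays N (phi_ n) (t_ n).
  by apply: tube_subset (tub n); case/andP: (c01 n).
have [||||k' ik' [z zP]] :=
    @admissible_cvg _ _ calR N (t_ \o k) (phi_ \o k) N_admissible.
- by move=> n; exact: t0.
- exact: kt.
- by move=> n; exact: phiR.
- by move=> n; exact: stN.
have Lz : L z.
  apply: (@late_limits_cvg _ _ _ N (t_ \o k \o k') (phi_ \o k \o k')) zP => //=.
  exact: cvg_subseq ik' kt.
have := cvg_dist_to L0 zP; rewrite dist_to0// => dL.
have : a / 2 <= 0.
  apply: (cvgr_to_ge dL); apply: nearW => n /=.
  set j := k (k' n); have := av j; have /andP[cj0 cj1] := c01 j.
  have /andP[aj1 aj2] := alpha_bounds (t0 j).
  have dj := dist_to_ge0 L (ev (phi_ j) (t_ j)).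
  have : c_ j * alpha (t_ j) <= 2 by nra.
  by rewrite -/(phi_ j) -/(t_ j); nra.
lra.
Qed.

(** If the times tend to infinity, the limit path stays in [N] forever, hence in the inner tube by
    the excursion hypothesis; then [c = 1] and a long enough time attain a value above [a]. *)
Lemma attains_one_limit (a : R) (delta : R) (x : X) (x_ : nat -> X) : 0 < a < 2 ->
  (forall phi, calR phi ->
    dist_to K (ev phi 0) < delta -> (forall t : R, 0 <= t -> N (ev phi t)) ->
    forall t : R, 0 <= t -> dist_to K (ev phi t) <= rho) ->
  dist_to K x < delta ->
  (forall n, exists2 v, a <= v & attains (fun=> 1) (x_ n) v) ->
  x_ n @[n --> \oo] --> x ->
  exists2 v, a <= v & attains (fun=> 1) x v.
Proof.
move=> /andP[a0 a2] noexc xdelta xP xx.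
have /choice[p pP] : forall n, exists p : (Rplus R -> X) * (R * R), [/\ calR p.1,
    ev p.1 0 = x_ n, 0 <= p.2.1, 0 <= p.2.2 <= 1 & tube p.1 p.2.1 p.2.2 /\
    a <= p.2.2 * alpha p.2.1 * 1].
  move=> n; have [v av [phi [t [c [Rphi phi0 t0 c01 [tub vE]]]]]] := xP n.
  by exists (phi, (t, c)); split => //=; rewrite -vE.
pose phi_ n := (p n).1; pose t_ n := (p n).2.1; pose c_ n := (p n).2.2.
have phiR n : calR (phi_ n) by have [] := pP n.
have phi0 n : ev (phi_ n) 0 = x_ n by have [] := pP n.
have t0 n : 0 <= t_ n by have [] := pP n.
have c01 n : 0 <= c_ n <= 1 by have [] := pP n.
have tub n : tube (phi_ n) (t_ n) (c_ n) by have [_ _ _ _ []] := pP n.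
have av n : a <= c_ n * alpha (t_ n) * 1 by have [_ _ _ _ []] := pP n.
have kx k : increasing_seq k -> ev (phi_ (k n)) 0 @[n --> \oo] --> x.
  by move=> ik; rewrite (eq_cvg _ _ (fun n => phi0 (k n))); exact: cvg_subseq ik xx.
have [[k ik kt]|[k ik [t _ kt]]] := cvg_to_or_infty t0; last first.
  apply: (@attains_limit _ a x (phi_ \o k) (t_ \o k) (c_ \o k) t) => //=.
  - by move=> ?; exact: cvg_cst.
  - exact: kx.
have [||phi [k' [Rphi phix ik' ck]]] :=
  @limit_trajectory _ _ _ calR_cont (phi_ \o k) x hK4.
- by move=> n; exact: phiR.
- exact: kx.
have phiN s : 0 <= s -> N (ev phi s).
  move=> s0; have cs : ev (phi_ (k (k' n))) s @[n --> \oo] --> ev phi s.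
    exact: (ck (fun=> s) s (fun=> s0) (cvg_cst _)).
  have kkt := cvg_subseq ik' kt.
  have cN : closed N by case: N_isolating.
  apply: (closed_lim cN _ cs).
  move/cvgryPge : kkt => /(_ s); apply: filterS => n /= sn.
  have /andP[cn0 _] := c01 (k (k' n)).
  by apply: (tube_subset cn0 (tub _)); rewrite s0.
have [t tge0 at_] := alpha_ge a2.
exists (alpha t) => //; exists phi, t, 1; split => //; first by rewrite ler01 lexx.
split; last by rewrite mul1r mulr1.
move=> s /andP[s0 _]; rewrite (_ : (2 - 1) * rho = rho); last lra.
by apply: noexc => //; rewrite phix.
Qed.

(** Otherwise there are points at distance at least [delta] from [K], ever closer to [L] and staying
    in [N] ever longer. They subconverge to a late limit with a forward trajectory in [N], that is,
    to a point of [K]. *)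
Lemma attains_near (delta : R) : 0 < delta -> exists2 e : R, 0 < e < 1 & forall x,
  (exists2 v, 2 - e <= v & attains (fun=> 1) x v) ->
  (forall v, attains (dist_to L) x v -> v <= e) -> dist_to K x < delta.
Proof.
move=> delta0; apply: contrapT => h; pose w n : R := n.+2%:R^-1.
have w0 n : 0 < w n by rewrite invr_gt0.
have w1 n : w n <= 1 / 2.
  by rewrite div1r lef_pV2 ?posrE// ler_nat.
have L0 : L !=set0.
  by case: K_nonempty => x Kx; exists x; apply: isolated_late N_isolating _ Kx.
have /choice[p pP] : forall n, exists p : (Rplus R -> X) * R, [/\ calR p.1,
    n%:R <= p.2, stays N p.1 p.2, dist_to L (ev p.1 0) <= 2 * w n &
    delta <= dist_to K (ev p.1 0)].
  move=> n; apply: contrapT => hn; apply: h; exists (w n).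
    by rewrite w0/=; have := w1 n; lra.
  move=> x [v wv [phi [t [c [Rphi phi0 t0 /andP[c0 c1] [tub vE]]]]]] xL.
  rewrite ltNge; apply/negP => dx; apply: hn; exists (phi, t).
  have wn1 := w1 n; have /andP[at1 at2] := alpha_bounds t0.
  (* A value near 2 forces both [c] and [alpha t] to be large, since [c <= 1] and [alpha t < 2]. *)
  have chalf : 1 / 2 <= c by move: wv; rewrite vE mulr1; nra.
  split => //=; rewrite ?phi0//.
  - have : 2 - w n <= alpha t by move: wv; rewrite vE mulr1; nra.
    rewrite /alpha lerD2l lerN2 lef_pV2 ?posrE//; last lra.
    by rewrite -natr1 -natr1; lra.
  - exact: tube_subset tub.
  (* The same path cut at time 0 attains [c] times the distance from [x] to [L], and [c] is at least
     one half. *)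
  - have /xL : attains (dist_to L) x (c * alpha 0 * dist_to L (ev phi 0)).
      exists phi, 0, c; split => //; first by rewrite c0.
      by split => // s /andP[s0 s1]; apply: tub; rewrite s0 (le_trans s1).
    by rewrite alpha0 mulr1 phi0; have := dist_to_ge0 L x; nra.
pose phi_ n := (p n).1; pose t_ n := (p n).2.
have phiR n : calR (phi_ n) by have [] := pP n.
have nt n : n%:R <= t_ n by have [] := pP n.
have phiN n : stays N (phi_ n) (t_ n) by have [] := pP n.
have [|k [z [ik Lz kz]]] := @late_limits_compact _ _ calR N
    (fun n => ev (phi_ n) 0) N_admissible L0.
  have w2 : 2 * w n @[n --> \oo] --> (0 : R).
    rewrite -(mulr0 2); apply: cvgM; first exact: cvg_cst.
    have := @cvg_harmonic R; rewrite -(@cvg_shiftn 1) /= => hw.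
    apply: cvg_trans hw; rewrite (_ : (fun n => _) = w)//.
    by apply/funext => n; rewrite /w /harmonic addn1.
  apply: (@squeeze_cvgr _ _ _ _ (fun=> 0) (fun n => 2 * w n)) => //.
    by apply: nearW => n; rewrite dist_to_ge0; have [] := pP n.
  exact: cvg_cst.
have [||phi [k' [Rphi phi0 ik' ck]]] :=
  @limit_trajectory _ _ _ calR_cont (phi_ \o k) z hK4.
- by move=> n; exact: phiR.
- exact: kz.
have Kz : K z.
  rewrite -phi0; apply: (late_limits_isolated calR_cont hK2 hK3 hK4 N_isolating) => //.
    by rewrite phi0.
  move=> s s0; have cs : ev (phi_ (k (k' n))) s @[n --> \oo] --> ev phi s.
    exact: (ck (fun=> s) s (fun=> s0) (cvg_cst _)).
  have cN : closed N by case: N_isolating.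
  apply: (closed_lim cN _ cs).
  have ikk := increasing_seq_comp ik ik'.
  have /cvgryPge koo := cvg_subseq ikk (@cvgr_idn R).
  near=> n; apply: phiN; rewrite s0 /=; apply: le_trans (nt _).
  by near: n; exact: (koo s).
have := cvg_dist_to K_nonempty kz; rewrite (dist_to0 Kz) => dK.
have : delta <= 0.
  by apply: (cvgr_to_ge dK); apply: nearW => n; have [] := pP (k n).
lra.
Unshelve. all: by end_near. Qed.

End attains.

(** * Restarting and continuity of trajectories through a point *)

Section trajectories_through.
Context {R : realType} {X : metricType R}.
Implicit Types (phi : Rplus R -> X).
Context (calR : set (Rplus R -> X)).
Hypothesis calR_cont : forall phi, calR phi -> continuous phi.
Hypothesis hK2 : condK2 calR.

Lemma trajectory_through_from (x : X) (delta1 : R) (sigma : R -> X) (t : R) :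
  trajectory_through calR x delta1 sigma -> - delta1 <= t ->
  calR (fun s : Rplus R => sigma (t + val s)).
Proof.
move=> [d0 Rs _] dt; have td : 0 <= t + delta1 by lra.
have := hK2 Rs td; congr calR; apply/funext => s; rewrite /Defs.shift toRplusK.
  by congr sigma; lra.
by rewrite addr_ge0// Rplus_ge0.
Qed.

Lemma trajectory_through_near (x : X) (delta1 : R) (sigma : R -> X) (U : set X) :
  trajectory_through calR x delta1 sigma -> open U -> U x ->
  exists2 e : R, 0 < e & forall t, - delta1 <= t -> - e <= t <= e -> U (sigma t).
Proof.
move=> [d0 Rs s0] oU Ux; pose phi : Rplus R -> X := fun t => sigma (- delta1 + val t).
have phiE t : - delta1 <= t -> ev phi (delta1 + t) = sigma t.
  move=> dt; rewrite /phi toRplusK; last lra.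
  by congr sigma; lra.
have phix : ev phi delta1 = x by rewrite -(addr0 delta1) phiE// oppr_le0.
have : \forall s \near delta1, U (ev phi s).
  apply: (@ev_continuous _ _ phi (calR_cont Rs) delta1).
  by apply: open_nbhs_nbhs; split; rewrite ?phix.
move=> /nbhs_ballP[e /= e0 he]; exists (e / 2); first by rewrite divr_gt0.
move=> t dt /andP[et te]; rewrite -phiE//; apply: he; rewrite /ball /=.
by rewrite opprD addrA subrr sub0r normrN ltr_norml; apply/andP; split; lra.
Qed.

Lemma trajectory_through_start phi : calR phi ->
  trajectory_through calR (ev phi 0) 0 (fun t => ev phi t).
Proof.
move=> Rphi; split => //; rewrite (_ : (fun t => _) = phi)//.
by apply/funext => t; rewrite oppr0 add0r toRplus_val.
Qed.

End trajectories_through.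

(** * Construction of the block and classification of its boundary points *)

Theorem theorem3p9 (R : realType) (X : metricType R)
    (calR : set (Rplus R -> X)) (K N : set X)
    (calR_cont : forall phi, calR phi -> continuous phi)
    (hK1 : condK1 calR) (hK2 : condK2 calR)
    (hK3 : condK3 calR) (hK4 : condK4 calR)
    (K_nonempty : K !=set0)
    (K_isolated : isolated_weakly_invariant calR K)
    (hK5 : condK5 calR K)
    (N_isolating : isolating_neighborhood calR K N)
    (N_admissible : admissible calR N) :
  exists B : set X, [/\ isolating_block calR K B, K `<=` B & B `<=` N].
Proof.
have [K_closed _ _] := K_isolated.
have [W [oW KW K5]] := hK5.
have [_ KN0 [K_wi _ maxK]] := N_isolating.
have [r r0 tubeU] : exists2 r : R, 0 < r & forall x, dist_to K x <= r -> (N° `&` W) x.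
  apply: (isolated_tube hK3 K_nonempty K_closed N_isolating N_admissible).
    by apply: openI => //; exact: open_interior.
  by move=> x Kx; split; [exact: KN0|exact: KW].
pose rho := r / 2; have rho0 : 0 < rho by rewrite divr_gt0.
have rho2 : 2 * rho = r by rewrite /rho; lra.
have tubeN x : dist_to K x <= 2 * rho -> N x.
  by rewrite rho2 => /tubeU[+ _]; exact: interior_subset.
have tubeW x : dist_to K x < 2 * rho -> W x by rewrite rho2 => /ltW/tubeU[].
have [delta0 delta00 noexc] := isolated_no_excursion calR_cont hK2 hK3 hK4
  K_nonempty K_closed N_isolating N_admissible rho0.
(* Halving the minimum keeps limits of points closer than [delta] to [K] strictly within the range
   [delta0] of the excursion bound. *)
pose delta : R := Num.min delta0 rho / 2.
have delta_gt0 : 0 < delta by rewrite divr_gt0// lt_min delta00.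
have [deltale deltarho] : delta < delta0 /\ delta < rho.
  have : Num.min delta0 rho <= delta0 by rewrite ge_min lexx.
  have : Num.min delta0 rho <= rho by rewrite ge_min lexx orbT.
  by move: delta_gt0; rewrite /delta => *; split; lra.
have [e /andP[e0 e1] near_e] := attains_near calR_cont hK2 hK3 hK4 K_nonempty
  N_isolating N_admissible rho0 tubeN delta_gt0.
pose L := late_limits calR N.
have L0 : L !=set0.
  by case: K_nonempty => x Kx; exists x; exact: (isolated_late hK3 N_isolating).
pose att := attains calR K rho.
(* In terms of suprema, [G] is the open set where [Z_1 > 2 - e], and [H] the closed set where
   [Z_{d(., L)} >= e]. *)
pose B := [set x | (exists2 v, 2 - e <= v & att (fun=> 1) x v) /\
                   forall v, att (dist_to L) x v -> v <= e].
pose G := [set x | exists2 v, 2 - e < v & att (fun=> 1) x v].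
pose H := [set x | exists2 v, e <= v & att (dist_to L) x v].
have BK x : B x -> dist_to K x < delta by move=> [h1 h2]; exact: near_e.
have oG : open G.
  apply: (attains_open calR_cont K_nonempty rho0 oW tubeW K5); last lra.
  by move=> ?; exact: cvg_cst.
have cH : closed H.
  exact: (attains_late_closed calR_cont hK3 hK4 K_nonempty N_isolating
    N_admissible rho0 tubeN).
(* The lower bound on [Z_1] passes to limits because [B] is close to [K]; the upper bound on
   [Z_{d(., L)}] does so by lower semicontinuity. *)
have cB : closed B.
  apply: closed_sequential => x u Bu ux; split.
    apply: (attains_one_limit calR_cont hK4 K_nonempty N_isolating rho0 tubeN
      _ noexc _ (fun n => (Bu n).1) ux); first by apply/andP; split; lra.
    apply: le_lt_trans deltale; apply: (cvgr_to_le (cvg_dist_to K_nonempty ux)).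
    by apply: nearW => n; apply/ltW/BK.
  have oE : open [set x | exists2 v, e < v & att (dist_to L) x v].
    apply: (attains_open calR_cont K_nonempty rho0 oW tubeW K5); last exact: ltW.
    exact: dist_to_continuous.
  move=> v av; rewrite leNgt; apply/negP => ev_.
  have := closed_lim (open_closedC oE) _ ux; apply; last by exists v.
  by apply: nearW => n [w ew /(Bu n).2]; rewrite leNgt ew.
have GHB x : G x -> ~ H x -> B° x.
  move=> Gx Hx; have oI : open (G `&` ~` H) by apply: openI => //; exact: closed_openC.
  suff : G `&` ~` H `<=` B° by apply.
  rewrite -open_subsetE// => y [[v v2 av] Hy]; split; first by exists v => //; exact: ltW.
  by move=> w aw; rewrite leNgt; apply/negP => ew; apply: Hy; exists w => //; exact: ltW.
have KG : K `<=` B°.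
  move=> x Kx; apply: GHB.
    (* The margin [e / 2] gives the strict inequality in [G]; a trajectory inside [K] permits
       [c = 1]. *)
    have [t t0 at_] := @alpha_ge R (2 - e / 2) ltac:(lra).
    exists (alpha t); first lra.
    have [phi [Rphi phi0 Kphi]] := isolated_forward N_isolating Kx.
    exists phi, t, 1; split => //; first by rewrite ler01 lexx.
    split; last by rewrite mul1r mulr1.
    by move=> s /andP[s0 _]; rewrite dist_to0; [apply: mulr_ge0; lra|exact: Kphi].
  move=> [v ev_ /(attains_late hK3 N_isolating rho0 tubeN Kx)[y Ly [c vE]]].
  by move: ev_; rewrite vE dist_to0// mulr0 leNgt e0.
have BN : B `<=` N.
  by move=> x /BK xd; apply: tubeN; lra.
(* Along a trajectory near K both quantities strictly decrease in time. *)
have step x delta1 sigma : B x -> trajectory_through calR x delta1 sigma ->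
  exists2 h : R, 0 < h & forall F t1 t2 v, - delta1 <= t1 -> - h <= t1 ->
    t1 < t2 -> t2 <= h -> 0 < v -> att F (sigma t2) v ->
    exists2 v', v < v' & att F (sigma t1) v'.
  move=> Bx ts.
  have oU : open [set y | dist_to K y < rho].
    have /continuousP/(_ _ (@open_lt R rho)) := dist_to_continuous K_nonempty.
    exact.
  have [|h h0 hU] := trajectory_through_near calR_cont ts oU.
    by rewrite /= (lt_trans (BK _ Bx)).
  exists h => // F t1 t2 v dt1 ht1 t12 t2h v0.
  have Rphi := trajectory_through_from hK2 ts dt1.
  pose phi : Rplus R -> X := fun s => sigma (t1 + val s).
  have phiE s : 0 <= s -> ev phi s = sigma (t1 + s) by move=> s0; rewrite /phi toRplusK.
  have t210 : 0 < t2 - t1 by rewrite subr_gt0.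
  have := @attains_strict _ _ calR K rho hK3 rho0 F phi (t2 - t1) v Rphi t210.
  have -> : ev phi (t2 - t1) = sigma t2 by rewrite phiE ?(ltW t210)// addrC subrK.
  rewrite phiE// addr0 => st av; apply: st => //.
  move=> u /andP[u0 ut]; rewrite phiE//; apply/ltW/hU; first lra.
  by apply/andP; split; lra.
(* A later point of [B] would push [Z_1] at [x] strictly above [2 - e], that is, put [x] in [G]. *)
have leave x delta1 sigma : B x -> ~ G x -> trajectory_through calR x delta1 sigma ->
    exists2 e2 : R, 0 < e2 & forall t, 0 < t <= e2 -> ~ B (sigma t).
  move=> Bx Gx ts; have [h h0 st] := step _ _ _ Bx ts; exists h => //.
  move=> t /andP[t0 th] [[v v2 av] _]; have [d0 _ sx] := ts.
  have [|||||v' vv' av'] := st _ 0 t v _ _ _ _ _ av; try lra.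
  by apply: Gx; exists v'; [lra|rewrite -sx].
(* At earlier times [Z_{d(., L)}] exceeds its value at [x], which is already at least [e] on [H]. *)
have back_out x delta1 sigma : B x -> H x -> trajectory_through calR x delta1 sigma ->
    0 < delta1 -> exists2 e1 : R, 0 < e1 < delta1 &
      forall t, - e1 <= t < 0 -> ~ B (sigma t).
  move=> Bx [v ev_ av] ts d0; have [h h0 st] := step _ _ _ Bx ts.
  have [_ _ sx] := ts; rewrite -sx in av.
  have m1 : Num.min h (delta1 / 2) <= h by rewrite ge_min lexx.
  have m2 : Num.min h (delta1 / 2) <= delta1 / 2 by rewrite ge_min lexx orbT.
  exists (Num.min h (delta1 / 2)).
    by rewrite lt_min h0 divr_gt0//=; lra.
  move=> t /andP[et t0] [_ Ht].
  have [|||||v' vv' av'] := st _ t 0 v _ _ _ _ _ av; try lra.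
  by have := Ht _ av'; lra.
(* At earlier times [Z_1] is larger, and the complement of the closed set [H] still contains the
   trajectory. *)
have back_in x delta1 sigma : B x -> ~ H x -> trajectory_through calR x delta1 sigma ->
    0 < delta1 -> exists2 e1 : R, 0 < e1 < delta1 &
      forall t, - e1 <= t < 0 -> B (sigma t).
  move=> Bx Hx ts d0; have [h h0 st] := step _ _ _ Bx ts.
  have [_ _ sx] := ts; have [[v v2 av] _] := Bx; rewrite -sx in av.
  have [h' h'0 nH] := trajectory_through_near calR_cont ts (closed_openC cH) Hx.
  have m1 : Num.min (Num.min h h') (delta1 / 2) <= h by rewrite !ge_min lexx.
  have m2 : Num.min (Num.min h h') (delta1 / 2) <= h' by rewrite !ge_min lexx orbT.
  have m3 : Num.min (Num.min h h') (delta1 / 2) <= delta1 / 2 by rewrite ge_min lexx orbT.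
  exists (Num.min (Num.min h h') (delta1 / 2)).
    by rewrite !lt_min h0 h'0 divr_gt0//=; lra.
  move=> t /andP[et t0]; split.
    have [|||||v' vv' av'] := st _ t 0 v _ _ _ _ _ av; try lra.
    by exists v' => //; lra.
  move=> w aw; rewrite leNgt; apply/negP => ew.
  apply: (nH t); [lra|by apply/andP; split; lra|].
  by exists w => //; exact: ltW.
(* Openness of [G] keeps the first condition strict; a later point of [H] would give [x] a value
   above [e]. *)
have enter x delta1 sigma : B x -> G x -> trajectory_through calR x delta1 sigma ->
    exists2 e2 : R, 0 < e2 & forall t, 0 < t <= e2 -> B° (sigma t).
  move=> Bx Gx ts; have [h h0 st] := step _ _ _ Bx ts; have [d0 _ sx] := ts.
  have [h' h'0 hG] := trajectory_through_near calR_cont ts oG Gx.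
  have m1 : Num.min h h' <= h by rewrite ge_min lexx.
  have m2 : Num.min h h' <= h' by rewrite ge_min lexx orbT.
  exists (Num.min h h'); first by rewrite lt_min h0.
  move=> t /andP[t0 th]; apply: GHB.
    by apply: hG; [lra|apply/andP; split; lra].
  move=> [v ev_ av].
  have [|||||v' vv' av'] := st _ 0 t v _ _ _ _ _ av; try lra.
  by rewrite sx in av'; have := Bx.2 _ av'; lra.
have bdB x : boundary B x -> B x by move=> [+ _]; exact: cB.
have bdGH x : boundary B x -> G x -> H x.
  by move=> [_ Bx] Gx; apply: contrapT => Hx; apply: Bx; exact: GHB.
(* The exit conditions quantify over all trajectories, so (K1) provides one on which leaving and
   entering contradict each other. *)
have exitG x : exit_set calR B x -> ~ G x.
  move=> ex Gx; have [bx out] : boundary B x /\ forall delta1 sigma,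
      trajectory_through calR x delta1 sigma ->
      exists2 e2 : R, 0 < e2 & forall t, 0 < t <= e2 -> ~ B (sigma t).
    by case: ex => -[bx h]; split => // d s ts; have [] := h d s ts.
  have [phi Rphi phix] := hK1 x.
  have := trajectory_through_start Rphi; rewrite phix => ts.
  have [a a0 ha] := out _ _ ts; have [b b0 hb] := enter _ _ _ (bdB _ bx) Gx ts.
  have m1 : Num.min a b <= a by rewrite ge_min lexx.
  have m2 : Num.min a b <= b by rewrite ge_min lexx orbT.
  have m0 : 0 < Num.min a b by rewrite lt_min a0.
  have /ha : 0 < Num.min a b <= a by rewrite m0.
  by apply; apply: interior_subset; apply: hb; rewrite m0.
(* Outside [G] every trajectory leaves at once; membership in [H] decides between bounce-off and
   egress. *)
have exitE : exit_set calR B = boundary B `&` ~` G.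
  apply/seteqP; split => [x ex|x [bx Gx]].
    by split; [case: ex => -[]|exact: exitG].
  have Bx := bdB _ bx; have [Hx|Hx] := pselect (H x).
    by right; split => // d s ts; split; [exact: (leave x d s)|exact: (back_out x d s)].
  by left; split => // d s ts; split; [exact: (leave x d s)|exact: (back_in x d s)].
exists B; split => //; last by move=> x /KG; exact: interior_subset.
split => //.
- split => //; split => //; first by move=> x /KG; exact: interior_subset.
  by move=> A wA AB; apply: maxK => // x /AB/BN.
- apply/seteqP; split => [x bx|x [|[]//]]; last by rewrite exitE => -[].
  have [Gx|Gx] := pselect (G x); last by left; rewrite exitE.
  right; split => // d s ts; have Bx := bdB _ bx.
  by split; [exact: (enter x d s)|exact: (back_out x d s Bx (bdGH _ bx Gx))].
- rewrite exitE; apply: closedI; last exact: open_closedC.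
  apply: closedI; first exact: closed_closure.
  by apply: open_closedC; exact: open_interior.
Qed.
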